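(* Let $d_0$, $n$ and $L$ be positive integers. Let $B\in M_{L}(\mathcal{O}_E)$ be a matrix such that its $i$-th smallest elementary divisor $s_i$ satisfies $s_i\geq\lfloor\frac{i-1}{d_0}\rfloor$ for any $i$. Put $\varepsilon_0=d(B,0)$ and $$C_1(n,d_0,\varepsilon_0)=p^n\left(\frac{4+d_0 p^n-d_0}{4+2d_0p^n-2\varepsilon_0}\right)\in (0,p^n).$$ Put $q_1=r_1=0$ and, for any $l\geq 2$, write $q_l=\lfloor\frac{l-2}{d_0}\rfloor$ and $r_l=l-2-d_0q_l$. Define $$C_2(n,d_0,\varepsilon_0)=\min\left\{\frac{2p^n+d_0q_l(q_l-1)+2q_l(r_l+1)}{2(l-\varepsilon_0)}\ \middle|\ l\in\mathbb{Z},\ \varepsilon_0< l\leq 1+d_0 p^n\right\}$$ and put $$C(n,d_0,\varepsilon_0)=\min\{C_1(n,d_0,\varepsilon_0),C_2(n,d_0,\varepsilon_0)\}\in (0,p^n).$$ Let $B'\in M_L(\mathcal{O}_E)$ be any matrix satisfying $B'-B\in \wp^{p^n}M_L(\mathcal{O}_E)$. Let $a$ be any non-negative rational number satisfying $a<C(n,d_0,\varepsilon_0)$. Then $d(B,a)=d(B',a)$.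
   Context: Let $p$ be a prime, $q>1$ a power of $p$, $A=\mathbb{F}_q[t]$, $K=\mathbb{F}_q(t)$, $\wp\in A$ an irreducible polynomial of positive degree, $K_\wp$ the $\wp$-adic completion of $K$, $\mathbb{C}_\wp$ the completion of an algebraic closure of $K_\wp$, and $v_\wp$ the additive valuation on $\mathbb{C}_\wp$ normalized by $v_\wp(\wp)=1$. $E/K_\wp$ is a finite extension inside $\mathbb{C}_\wp$ with ring of integers $\mathcal{O}_E$. The elementary divisors $s_1\le s_2\le\cdots\le s_L$ of a matrix in $M_L(\mathcal{O}_E)$ are the values of $v_\wp$ (in $\mathbb{Q}\cup\{+\infty\}$) on the diagonal entries of its Smith normal form. For a square matrix $B$ over $E$ and a rational number $a$, $d(B,a)$ is the number of eigenvalues $\lambda\in\mathbb{C}_\wp$ of $B$, counted with (algebraic) multiplicity, with $v_\wp(\lambda)=a$. *)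

(* Defs.v *)
From HB Require Import structures.
From mathcomp Require Import all_boot all_order all_algebra all_field.
From mathcomp Require Import boolp classical_sets fsbigop constructive_ereal.

Set Implicit Arguments.
Unset Strict Implicit.
Unset Printing Implicit Defensive.

Import Order.TTheory GRing.Theory Num.Theory.

Local Open Scope classical_set_scope.
Local Open Scope ring_scope.

Record is_valuation (K : fieldType) (v : K -> \bar rat) : Prop := {
  val_eq_pinfty : forall x, (v x == +oo%E) = (x == 0);
  val_neq_ninfty : forall x, v x != -oo%E;
  val_mul : forall x y, v (x * y)%R = (v x + v y)%E;
  val_add_ge_min : forall x y, (Order.min (v x) (v y) <= v (x + y)%R)%E }.

Definition val_cauchy (K : fieldType) (v : K -> \bar rat) (u : nat -> K) : Prop :=
  forall M : rat, exists N : nat, forall i j : nat,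
    (N <= i)%N -> (N <= j)%N -> (M%:E <= v (u i - u j)%R)%E.

Definition val_cvg (K : fieldType) (v : K -> \bar rat) (u : nat -> K) (l : K) : Prop :=
  forall M : rat, exists N : nat, forall i : nat,
    (N <= i)%N -> (M%:E <= v (u i - l)%R)%E.

(* A completion is determined by these conditions up to a unique isometric
   isomorphism under K. *)
Record is_completion (K L : fieldType) (v : K -> \bar rat) (w : L -> \bar rat)
    (j : {rmorphism K -> L}) : Prop := {
  completion_val : is_valuation w;
  completion_extends : forall x, w (j x) = v x;
  completion_complete : forall u : nat -> L,
    val_cauchy w u -> exists l, val_cvg w u l;
  completion_dense : forall (x : L) (M : rat),
    exists y : K, (M%:E <= w (x - j y)%R)%E }.

(* The index bound loses nothing for wp of positive degree and f != 0, since
   wp ^+ i %| f then forces i < size f. *)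
Definition poly_mult (F : fieldType) (wp f : {poly F}) : nat :=
  \max_(i < size f | wp ^+ i %| f) i.

Definition adic_val (F : fieldType) (wp : {poly F}) (x : {fraction {poly F}}) :
    \bar rat :=
  if x == 0 then +oo%E
  else ((poly_mult wp \n_(repr x))%:R - (poly_mult wp \d_(repr x))%:R)%:E.

Definition val_ring (K : fieldType) (v : K -> \bar rat) : {pred K} :=
  fun x => (0 <= v x)%E.

Definition GL_val_ring (K : fieldType) (v : K -> \bar rat) (L : nat)
    (U : 'M[K]_L) : Prop :=
  [/\ U \is a mxOver (val_ring v), U \in unitmx
    & invmx U \is a mxOver (val_ring v)].

(* The divisibility chain of a Smith normal form over a valuation ring is the
   monotonicity of the valuations of its diagonal entries. The i-th smallest
   elementary divisor, counted from 1, is s at index i - 1. *)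
Definition elementary_divisors (K : fieldType) (v : K -> \bar rat) (L : nat)
    (B : 'M[K]_L) (s : 'I_L -> \bar rat) : Prop :=
  (forall i j : 'I_L, (i <= j)%N -> (s i <= s j)%E) /\
  exists (U V : 'M[K]_L) (D : 'rV[K]_L),
    [/\ GL_val_ring v U, GL_val_ring v V, D \is a mxOver (val_ring v),
        U *m B *m V = diag_mx D & forall i, s i = v (D ord0 i)].

Definition mx_congr (K : fieldType) (v : K -> \bar rat) (c : K) (L : nat)
    (B B' : 'M[K]_L) : Prop :=
  exists2 D : 'M[K]_L, D \is a mxOver (val_ring v) & B' - B = c *: D.

(* The multiplicity of an eigenvalue is its multiplicity as a root of the
   characteristic polynomial. *)
Definition slope_mult (E C : fieldType) (j : {rmorphism E -> C})
    (v : C -> \bar rat) (L : nat) (B : 'M[E]_L) (a : rat) : nat :=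
  let BC := map_mx j B in
  (\sum_(x \in [set x : C | eigenvalue BC x /\ v x = a%:E])
     mup x (char_poly BC))%R.

Definition C1 (p n d0 eps0 : nat) : rat :=
  (p ^ n)%N%:R *
  ((4 + d0%:R * (p ^ n)%N%:R - d0%:R) /
   (4 + 2 * d0%:R * (p ^ n)%N%:R - 2 * eps0%:R)).

Definition C2_q (d0 l : nat) : nat := if (l <= 1)%N then 0%N else ((l - 2) %/ d0)%N.

Definition C2_r (d0 l : nat) : nat :=
  if (l <= 1)%N then 0%N else (l - 2 - d0 * C2_q d0 l)%N.

Definition C2_term (p n d0 eps0 l : nat) : rat :=
  (2 * (p ^ n)%N%:R + d0%:R * (C2_q d0 l)%:R * ((C2_q d0 l)%:R - 1)
   + 2 * (C2_q d0 l)%:R * ((C2_r d0 l)%:R + 1))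
  / (2 * (l%:R - eps0%:R)).

(* Minimum over eps0 < l <= 1 + d0 * p ^ n. The default value is the term at
   l = eps0 + 1, which belongs to the range as soon as the range is nonempty. *)
Definition C2 (p n d0 eps0 : nat) : rat :=
  \big[Num.min/C2_term p n d0 eps0 eps0.+1]_(eps0.+1 <= l < (1 + d0 * p ^ n).+1)
    C2_term p n d0 eps0 l.

Definition Cmin (p n d0 eps0 : nat) : rat :=
  Num.min (C1 p n d0 eps0) (C2 p n d0 eps0).

(* Main.v *)
Require Import Defs.
From HB Require Import structures.
From mathcomp Require Import all_boot all_order all_algebra all_field.
From mathcomp Require Import boolp classical_sets fsbigop constructive_ereal.
From mathcomp Require Import perm ring lra zify.

(* Put [N = p ^ n] and [T l = \sum_(i < l) min (i / d0) N]. If [U B V = D] is a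
   Smith normal form, [char_poly B] is up to a unit [\det (X U V - D)]. Expanding
   this determinant row by row shows that its coefficient of [X ^ (L - l)] has
   valuation at least [T l], and that it moves by at least [N + T (l - 1)] when
   [B] is replaced by [B']. The number of roots of valuation [a] is read off the
   indices [k] where [v c_k + a k] is minimal, and the [eps0] unit eigenvalues
   force this minimum to be at most [a (L - eps0)]. The bound [a < C] says that
   [a (l - eps0) < N + T (l - 1)] for all [l], so the perturbation is too small to
   affect these indices.
   It is not needed that [C_wp] is algebraically closed: the eigenvalues are
   algebraic over [K_wp], hence come from its algebraic closure. *)

Set Implicit Arguments.
Unset Strict Implicit.
Unset Printing Implicit Defensive.

Import Order.TTheory GRing.Theory Num.Theory.

Local Open Scope ring_scope.

(** * Valuation estimates for sums, products and determinants *)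

Section Valuation.
Variables (K : fieldType) (v : K -> \bar rat).
Hypothesis hv : is_valuation v.

Lemma valuation0 : v 0 = +oo%E.
Proof. by apply/eqP; rewrite (val_eq_pinfty hv). Qed.

Lemma valuation1 : v 1 = 0%E.
Proof.
have := val_mul hv 1 1; rewrite mulr1.
have := val_neq_ninfty hv 1; have := val_eq_pinfty hv 1; rewrite oner_eq0.
by case: (v 1) => [r| |] // _ _ [] h; congr (_%:E); lra.
Qed.

Lemma valuationN x : v (- x) = v x.
Proof.
have h1 : v (- 1) = 0%E.
  have := val_mul hv (- 1) (- 1); rewrite mulrNN mulr1 valuation1.
  by case: (v (- 1)) => [r| |] // [] h; congr (_%:E); lra.
by rewrite -mulN1r (val_mul hv) h1 add0e.
Qed.

Lemma val_geM r t x y :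
  (r%:E <= v x -> t%:E <= v y -> (r + t)%:E <= v (x * y)%R)%E.
Proof. by move=> hx hy; rewrite (val_mul hv) EFinD leeD. Qed.

Lemma val_gtM r t x y :
  (r%:E < v x -> t%:E <= v y -> (r + t)%:E < v (x * y)%R)%E.
Proof.
rewrite (val_mul hv); case: (v x) => [x'| |] //; case: (v y) => [y'| |] //.
- by rewrite -EFinD !lte_fin !lee_fin => *; lra.
- by rewrite addey // => _ _; apply: ltry.
- by rewrite addye // => _ _; apply: ltry.
by rewrite addye // => _ _; apply: ltry.
Qed.

Lemma val_geD r x y : (r%:E <= v x -> r%:E <= v y -> r%:E <= v (x + y)%R)%E.
Proof.
by move=> hx hy; apply: le_trans (val_add_ge_min hv _ _); rewrite le_min hx.
Qed.

Lemma val_gtD r x y : (r%:E < v x -> r%:E < v y -> r%:E < v (x + y)%R)%E.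
Proof.
by move=> hx hy; apply: lt_le_trans (val_add_ge_min hv _ _); rewrite lt_min hx.
Qed.

Lemma val_eqD r x y : v x = r%:E -> (r%:E < v y)%E -> v (x + y) = r%:E.
Proof.
move=> hx hy; apply/eqP; rewrite eq_le val_geD ?hx ?(ltW hy) // andbT.
rewrite leNgt; apply/negP => h.
have := val_gtD h (y := - y); rewrite addrK hx valuationN ltxx.
by move/(_ hy).
Qed.

Lemma val_ge_weaken r t x : t <= r -> (r%:E <= v x -> t%:E <= v x)%E.
Proof. by move=> h; apply: le_trans; rewrite lee_fin. Qed.

Lemma val_ge_sum (I : Type) (s : seq I) (P : pred I) (F : I -> K) r :
  (forall i, P i -> (r%:E <= v (F i))%E) ->
  (r%:E <= v (\sum_(i <- s | P i) F i)%R)%E.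
Proof.
move=> h; elim/big_ind: _ => //; last by move=> *; apply: val_geD.
by rewrite valuation0 leey.
Qed.

Lemma val_integral_prod (I : Type) (s : seq I) (P : pred I) (F : I -> K) :
  (forall i, P i -> 0 <= v (F i))%E ->
  (0 <= v (\prod_(i <- s | P i) F i)%R)%E.
Proof.
move=> h; elim/big_ind: _ => //; first by rewrite valuation1.
by move=> x y hx hy; rewrite -[0%E]/((0 + 0 : rat)%:E); apply: val_geM.
Qed.

Lemma val_integralM x y : (0 <= v x -> 0 <= v y -> 0 <= v (x * y)%R)%E.
Proof. by move=> hx hy; rewrite (val_mul hv) adde_ge0. Qed.

Lemma val_integral_mulmx (a b c : nat) (M : 'M[K]_(a, b)) (M' : 'M[K]_(b, c)) :
  M \is a mxOver (val_ring v) -> M' \is a mxOver (val_ring v) ->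
  M *m M' \is a mxOver (val_ring v).
Proof.
move=> /mxOverP hM /mxOverP hM'; apply/mxOverP => i j; rewrite mxE.
apply: val_ge_sum => k _; apply: val_integralM; [exact: hM|exact: hM'].
Qed.

Lemma val_signM (b : bool) x : v ((-1) ^+ b * x) = v x.
Proof. by rewrite mulr_sign; case: b => //; rewrite valuationN. Qed.

Lemma val_integral_det n (M : 'M[K]_n) :
  M \is a mxOver (val_ring v) -> (0 <= v (\det M))%E.
Proof.
move=> /mxOverP hM; apply: val_ge_sum => s _; rewrite val_signM.
by apply: val_integral_prod => i _; apply: hM.
Qed.

(** [\det U] and the determinant of the inverse both have nonnegative valuation, and these add up to
    [v 1 = 0]. *)
Lemma val_det_GL n (U : 'M[K]_n) : GL_val_ring v U -> v (\det U) = 0%E.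
Proof.
case=> hU uU hU'; have h1 := val_integral_det hU; have h2 := val_integral_det hU'.
have : v (\det U * \det (invmx U)) = 0%E.
  by rewrite -det_mulmx mulmxV // det1 valuation1.
rewrite (val_mul hv); move: h1 h2.
case: (v _) => [x| |] //; case: (v _) => [y| |] //.
by rewrite !lee_fin => h1 h2 [] h; congr (_%:E); lra.
Qed.

(** * Newton polygon segments and roots of split polynomials *)

(* The index range of the segment of slope [- a] of the Newton polygon of [P]:
   [m] is the least value of [v P_k + a k], and [i], [j] are the first and the
   last [k] where it is attained. *)
Definition newton_segment (a : rat) (P : {poly K}) (m : rat) (i j : nat) :=
  [/\ forall k, ((m - a * k%:R)%:E <= v P`_k)%E,
      v P`_i = (m - a * i%:R)%:E, v P`_j = (m - a * j%:R)%:E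
    & forall k, (k < i)%N || (j < k)%N -> ((m - a * k%:R)%:E < v P`_k)%E].

(** Both minima are attained, so each bounds the other. Strictness outside either index range then
    puts its endpoints inside the other. *)
Lemma newton_segment_uniq a P m i j m' i' j' :
  newton_segment a P m i j -> newton_segment a P m' i' j' ->
  i = i' /\ j = j'.
Proof.
move=> [h1 h2 h3 h4] [h1' h2' h3' h4'].
have em : m = m'.
  apply/eqP; rewrite eq_le; apply/andP; split.
    by have := h1 i'; rewrite h2' lee_fin; lra.
  by have := h1' i; rewrite h2 lee_fin; lra.
subst m'; have H k : ~~ ((m - a * k%:R)%:E < v P`_k)%E ->
    ((i <= k <= j) && (i' <= k <= j'))%N.
  move=> h; move: (contra (@h4 k) h) (contra (@h4' k) h).
  by rewrite !negb_or -!leqNgt => -> ->.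
have := H i; have := H i'; have := H j; have := H j'.
rewrite h2 h2' h3 h3' !ltxx => /(_ isT) ? /(_ isT) ? /(_ isT) ? /(_ isT) ?.
lia.
Qed.

Lemma newton_segment_perturb a (P Q : {poly K}) m i j :
  newton_segment a P m i j ->
  (forall k, ((m - a * k%:R)%:E < v (Q`_k - P`_k)%R)%E) ->
  newton_segment a Q m i j.
Proof.
move=> [h1 h2 h3 h4] hd; have e k : Q`_k = P`_k + (Q`_k - P`_k) by ring.
split=> [k|||k hk].
- by rewrite e val_geD // ltW.
- by rewrite e (val_eqD h2).
- by rewrite e (val_eqD h3).
- by rewrite e val_gtD // h4.
Qed.

Lemma newton_segment1 a : newton_segment a 1 0 0 0.
Proof.
split=> [k|||k]; rewrite coef1.
- by case: k => [|k] /=; rewrite ?valuation1 ?valuation0 ?leey // lee_fin; lra.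
- by rewrite valuation1; congr (_%:E); lra.
- by rewrite valuation1; congr (_%:E); lra.
by case: k => //= k _; rewrite valuation0 ltry.
Qed.

(** The new coefficients are [P_(k-1) - x P_k]. The first term has minimal level [m + a], the second
    [m + v x]: the smaller dominates, and a tie lengthens the segment by one. *)
Lemma newton_segment_mulXsubC a P m i j x :
  newton_segment a P m i j ->
  exists m', [/\ m' <= m + a, forall r, v x = r%:E -> m' <= m + r &
    newton_segment a (P * ('X - x%:P)) m'
      (i + (a%:E < v x)%E) (j + (a%:E <= v x)%E)].
Proof.
move=> [h1 h2 h3 h4].
have cE k : (P * ('X - x%:P))`_k
    = (if k is k'.+1 then P`_k' else 0) + (- (P`_k * x)).
  by rewrite mulrBr coefB coefMX coefMC; case: k.
have nS (k : nat) : k.+1%:R = k%:R + 1 :> rat by rewrite -addn1 natrD.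
case: (ltgtP (v x) a%:E) => [hx|hx|hx].
- have [r er] : exists r, v x = r%:E.
    by move: hx (val_neq_ninfty hv x); case: (v x) => [r| |] // _ _; exists r.
  move: hx; rewrite er lte_fin => ra.
  exists (m + r); split; [lra|by move=> t [] ->|rewrite !addn0].
  have H1 k : ((m + r - a * k%:R)%:E
      < v (if k is k'.+1 then P`_k' else 0))%E.
    case: k => [|k]; first by rewrite valuation0 ltry.
    apply: lt_le_trans (h1 k); rewrite lte_fin nS; lra.
  have H2 k : v (P`_k * x) = (v P`_k + r%:E)%E by rewrite (val_mul hv) er.
  split=> [k|||k hk]; rewrite cE.
  + apply: val_geD; first exact: ltW.
    rewrite valuationN.
    rewrite (_ : _ - _ = m - a * k%:R + r); last by ring.
    by apply: val_geM; rewrite ?er.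
  + rewrite addrC; apply: val_eqD => //; rewrite valuationN H2 h2 -EFinD.
    by congr (_%:E); ring.
  + rewrite addrC; apply: val_eqD => //; rewrite valuationN H2 h3 -EFinD.
    by congr (_%:E); ring.
  + apply: val_gtD => //; rewrite valuationN.
    rewrite (_ : _ - _ = m - a * k%:R + r); last by ring.
    by apply: val_gtM; rewrite ?er // h4.
- exists (m + a); split=> //.
    by move=> r er; move: hx; rewrite er lte_fin; lra.
  rewrite !addn1.
  have H k : ((m + a - a * k%:R)%:E < v (- (P`_k * x)))%E.
    rewrite valuationN [P`_k * x]mulrC.
    rewrite (_ : _ - _ = a + (m - a * k%:R)); last by ring.
    by apply: val_gtM.
  have E k : m + a - a * k.+1%:R = m - a * k%:R by rewrite nS; ring.
  split=> [k|||k hk]; rewrite cE.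
  + apply: val_geD; last exact: ltW.
    by case: k => [|k]; rewrite ?valuation0 ?leey // E.
  + by apply: val_eqD => //; rewrite E.
  + by apply: val_eqD => //; rewrite E.
  + apply: val_gtD => //.
    by case: k hk => [|k] hk; rewrite ?valuation0 ?ltry // E h4.
- exists (m + a); split=> //; first by move=> r; rewrite hx => -[] ->.
  rewrite addn0 addn1.
  have E k : m + a - a * k.+1%:R = m - a * k%:R by rewrite nS; ring.
  have E' k : m + a - a * k%:R = (m - a * k%:R) + a by ring.
  split=> [k|||k hk]; rewrite cE.
  + apply: val_geD; first by case: k => [|k]; rewrite ?valuation0 ?leey // E.
    by rewrite valuationN E'; apply: val_geM; rewrite ?hx.
  (* In a tie the left end comes from [x P_i], as [P_(i-1)] lies strictly above the segment; the
     right end comes from [P_j], as [x P_(j+1)] does. *)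
  + rewrite addrC; apply: val_eqD.
      by rewrite valuationN (val_mul hv) h2 hx -EFinD; congr (_%:E); ring.
    by case: (i) h4 => [|k] h4; rewrite ?valuation0 ?ltry // E h4 // ltnSn.
  + apply: val_eqD; first by rewrite E.
    rewrite valuationN E'; apply: val_gtM; last by rewrite hx.
    by rewrite h4 // ltnSn orbT.
  + apply: val_gtD.
      case: k hk => [|k] hk; rewrite ?valuation0 ?ltry // E h4 //; lia.
    by rewrite valuationN E'; apply: val_gtM; rewrite ?hx // h4 //; lia.
Qed.

(** Each root raises [m] by at most [a], and a root of valuation 0 does not raise it. Roots of
    valuation above [a] shift both ends, those of valuation [a] only the right one. *)
Lemma newton_segment_roots a (s : seq K) : 0 <= a ->
  exists2 m, m <= a * ((size s)%:R - (count (fun x => v x == 0%E) s)%:R) &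
    newton_segment a (\prod_(x <- s) ('X - x%:P)) m
      (count (fun x => a%:E < v x)%E s)
      (count (fun x => a%:E < v x)%E s + count (fun x => v x == a%:E) s).
Proof.
move=> a0; elim: s => [|x s [m hm hN]].
  by exists 0; rewrite ?big_nil /= ?subr0 ?mulr0 //; apply: newton_segment1.
have [m' [h1 h2 h3]] := newton_segment_mulXsubC x hN.
exists m' => /=.
  rewrite -add1n !natrD; case: eqP => [e|_] /=; last by lra.
  by have := h2 _ e; lra.
have le_split : nat_of_bool (a%:E <= v x)%E = ((a%:E < v x)%E + (v x == a%:E))%N.
  by case: ltgtP.
rewrite big_cons mulrC; rewrite le_split in h3.
have tr P i j i' j' : i = i' -> j = j' ->
  newton_segment a P m' i j -> newton_segment a P m' i' j' by move=> -> ->.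
by apply: tr h3; first exact: addnC; rewrite addnC -addnACA.
Qed.

End Valuation.

(** * Coefficient bounds for determinants of linear pencils *)

Section Pencil.
Variables (K : fieldType) (v : K -> \bar rat).
Hypothesis hv : is_valuation v.
Variables (mu : nat -> nat) (N : nat).
Hypothesis mu_mono : {homo mu : i j / (i <= j)%N}.

Definition psum (l : nat) : nat := \sum_(i < l) mu i.

Lemma psumS l : psum l.+1 = (psum l + mu l)%N.
Proof. by rewrite /psum big_ord_recr. Qed.

Let lin (a b : K) : {poly K} := a *: 'X + b%:P.

Let coef_mul_lin P a b k :
  (P * lin a b)`_k = (if k is k'.+1 then P`_k' * a else 0) + P`_k * b.
Proof.
rewrite mulrDr coefD -scalerAr coefZ coefMX coefMC.
by case: k => [|k] /=; rewrite ?mulr0 // mulrC.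
Qed.

Lemma psum_le_step k h x :
  (((psum (k - h) + mu k)%N%:R : rat)%:E <= v x)%E ->
  (((psum (k.+1 - h))%:R : rat)%:E <= v x)%E.
Proof.
apply: val_ge_weaken; rewrite ler_nat.
case: (leqP h k) => hk; last first.
  by rewrite (_ : (k.+1 - h = 0)%N) /psum ?big_ord0; lia.
by rewrite subSn // psumS leq_add2l mu_mono ?leq_subr.
Qed.

(** The coefficient of [X ^ h] takes the constant term in [k - h] factors, and since [mu] is
    nondecreasing the first [k - h] weights have the least sum. *)
Lemma coef_prod_lin_ge k (a b : 'I_k -> K) :
  (forall i, 0 <= v (a i))%E ->
  (forall i : 'I_k, ((mu i)%:R : rat)%:E <= v (b i))%E ->
  forall h, (((psum (k - h))%:R : rat)%:E
             <= v (\prod_(i < k) (a i *: 'X + (b i)%:P))`_h)%E.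
Proof.
elim: k a b => [|k IH] a b ha hb h.
  rewrite big_ord0 coef1 /psum sub0n big_ord0.
  by case: h => [|h] /=; rewrite ?(valuation1 hv) ?(valuation0 hv) ?leey ?lee_fin.
rewrite big_ord_recr /= -/(lin _ _) coef_mul_lin.
pose w := widen_ord (leqnSn k).
have {}IH := IH (a \o w) (b \o w) (fun i => ha _) (fun i => hb _).
apply: val_geD => //.
  case: h => [|h]; first by rewrite (valuation0 hv) leey.
  by rewrite subSS -[X in X%:E]addr0; apply: val_geM.
by apply: psum_le_step; rewrite natrD; apply: val_geM => //; apply: hb.
Qed.

(* For [h >= k] truncation turns the bound into [N]; nothing sharper is needed in
   high degrees, and the induction then requires no degree bookkeeping. *)
Lemma coef_prod_lin_sub_ge k (a b b' : 'I_k -> K) :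
  (forall i, 0 <= v (a i))%E ->
  (forall i : 'I_k, ((mu i)%:R : rat)%:E <= v (b i))%E ->
  (forall i : 'I_k, ((mu i)%:R : rat)%:E <= v (b' i))%E ->
  (forall i, (N%:R : rat)%:E <= v (b' i - b i)%R)%E ->
  forall h, (((N + psum (k - h).-1)%:R : rat)%:E
             <= v ((\prod_(i < k) (a i *: 'X + (b' i)%:P))`_h
                   - (\prod_(i < k) (a i *: 'X + (b i)%:P))`_h)%R)%E.
Proof.
elim: k a b b' => [|k IH] a b b' ha hb hb' hd h.
  by rewrite !big_ord0 subrr (valuation0 hv) leey.
pose w := widen_ord (leqnSn k).
have {}IH := IH (a \o w) (b \o w) (b' \o w) (fun i => ha _) (fun i => hb _)
  (fun i => hb' _) (fun i => hd _).
have P_ge := @coef_prod_lin_ge _ (a \o w) (b \o w) (fun i => ha _)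
  (fun i => hb _).
rewrite !big_ord_recr /= -!/(lin _ _) !coef_mul_lin -/w.
set P' := \prod_(i < k) lin (a (w i)) (b' (w i)).
set P := \prod_(i < k) lin (a (w i)) (b (w i)).
(* The first two differences are handled by induction; the last is the change of a constant term,
   worth [N], times a coefficient worth [psum (k - h)]. *)
have -> : forall X X' Y Y' c c' : K, X' + Y' * c' - (X + Y * c)
   = (X' - X) + ((Y' - Y) * c' + Y * (c' - c)) by move=> *; ring.
apply: val_geD => //; last apply: val_geD => //.
- case: h => [|h]; first by rewrite subrr (valuation0 hv) leey.
  by rewrite subSS -mulrBl -[X in X%:E]addr0; apply: val_geM => //; apply: IH.
- have H : (((N + psum (k - h).-1 + mu k)%N%:R : rat)%:E
    <= v ((P'`_h - P`_h) * b' ord_max)%R)%E.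
    by rewrite natrD; apply: val_geM => //; apply: hb'.
  apply: val_ge_weaken H; rewrite ler_nat -addnA leq_add2l.
  case: (leqP k h) => hk.
    by rewrite (_ : (k.+1 - h).-1 = 0)%N /psum ?big_ord0; lia.
  rewrite subSn ?(ltnW hk) //= -{1}(@prednK (k - h)) ?subn_gt0 // psumS leq_add2l.
  by rewrite mu_mono //; lia.
- rewrite mulrC natrD; apply: val_geM => //.
  by rewrite (_ : (k.+1 - h).-1 = k - h)%N; [apply: P_ge|lia].
Qed.

Definition pencil n (W M : 'M[K]_n) : 'M[{poly K}]_n :=
  \matrix_(i, j) (W i j *: 'X + (M i j)%:P).

Lemma coef_det_pencil n (W M : 'M[K]_n) h :
  (\det (pencil W M))`_h = \sum_(s : 'S_n)
    (-1) ^+ s * (\prod_(i < n) (W i (s i) *: 'X + (M i (s i))%:P))`_h.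
Proof.
rewrite /determinant coef_sum; apply: eq_bigr => s _.
rewrite (eq_bigr (fun i => W i (s i) *: 'X + (M i (s i))%:P)); last first.
  by move=> i _; rewrite mxE.
by rewrite !mulr_sign; case: (s : bool); rewrite ?coefN.
Qed.

Lemma det_pencil_ge n (W M : 'M[K]_n) :
  W \is a mxOver (val_ring v) ->
  (forall i j : 'I_n, ((mu i)%:R : rat)%:E <= v (M i j))%E ->
  forall h, (((psum (n - h))%:R : rat)%:E <= v (\det (pencil W M))`_h)%E.
Proof.
move=> /mxOverP hW hM h; rewrite coef_det_pencil; apply: val_ge_sum => // s _.
by rewrite val_signM //; apply: coef_prod_lin_ge => i; [apply: hW|apply: hM].
Qed.

Lemma det_pencil_sub_ge n (W M M' : 'M[K]_n) :
  W \is a mxOver (val_ring v) ->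
  (forall i j : 'I_n, ((mu i)%:R : rat)%:E <= v (M i j))%E ->
  (forall i j : 'I_n, ((mu i)%:R : rat)%:E <= v (M' i j))%E ->
  (forall i j, (N%:R : rat)%:E <= v (M' i j - M i j)%R)%E ->
  forall h, (((N + psum (n - h).-1)%:R : rat)%:E
     <= v ((\det (pencil W M'))`_h - (\det (pencil W M))`_h)%R)%E.
Proof.
move=> /mxOverP hW hM hM' hd h; rewrite !coef_det_pencil -sumrB.
apply: val_ge_sum => // s _; rewrite -mulrBr val_signM //.
by apply: coef_prod_lin_sub_ge => i;
  [apply: hW|apply: hM|apply: hM'|apply: hd].
Qed.

(** This is [X U V - U B V = U (X - B) V]. *)
Lemma det_pencil_char_poly n (U V B : 'M[K]_n) :
  \det (pencil (U *m V) (- (U *m B *m V)))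
    = (\det U * \det V) *: char_poly B.
Proof.
rewrite (_ : pencil _ _ = map_mx polyC U *m char_poly_mx B *m map_mx polyC V).
  rewrite !det_mulmx !det_map_mx -/(char_poly B) -mul_polyC polyCM; ring.
rewrite /char_poly_mx mulmxBr mulmxBl -!map_mxM mul_mx_scalar -scalemxAl -map_mxM.
apply/matrixP => i j; rewrite !mxE polyCN -mul_polyC mulrC.
by congr (_ + _).
Qed.

Lemma char_poly_coef_ge n (B U V : 'M[K]_n) (D : 'rV[K]_n) :
  GL_val_ring v U -> GL_val_ring v V -> U *m B *m V = diag_mx D ->
  (forall i : 'I_n, ((mu i)%:R : rat)%:E <= v (D ord0 i))%E ->
  forall h, (((psum (n - h))%:R : rat)%:E <= v (char_poly B)`_h)%E.
Proof.
move=> hU hV e hD h.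
have d0 : v (\det U * \det V) = 0%E by rewrite (val_mul hv) !val_det_GL.
have -> : v (char_poly B)`_h = v (\det (pencil (U *m V) (- (U *m B *m V))))`_h.
  by rewrite det_pencil_char_poly coefZ (val_mul hv) d0 add0e.
apply: det_pencil_ge => [|i j].
  by case: hU hV => ? _ _ [? _ _]; apply: val_integral_mulmx.
rewrite e !mxE valuationN //; case: (eqVneq i j) => _; first exact: hD.
by rewrite (valuation0 hv) leey.
Qed.

(** The same [U] and [V] serve for [B']. The matrix [U B' V] may fail to be diagonal, but it differs
    from [D] by [c U G V], of valuation at least [N]; as [mu i <= N], its rows satisfy the same
    bounds. *)
Lemma char_poly_sub_coef_ge n (B B' G U V : 'M[K]_n) (D : 'rV[K]_n) (c : K) :
  GL_val_ring v U -> GL_val_ring v V -> U *m B *m V = diag_mx D ->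
  (forall i : 'I_n, ((mu i)%:R : rat)%:E <= v (D ord0 i))%E ->
  (forall i, mu i <= N)%N ->
  ((N%:R : rat)%:E <= v c)%E -> G \is a mxOver (val_ring v) ->
  B' - B = c *: G ->
  forall h, (((N + psum (n - h).-1)%:R : rat)%:E
     <= v ((char_poly B')`_h - (char_poly B)`_h)%R)%E.
Proof.
move=> hU hV e hD hmu hc hG eB h.
have d0 : v (\det U * \det V) = 0%E by rewrite (val_mul hv) !val_det_GL.
have -> : v ((char_poly B')`_h - (char_poly B)`_h)
   = v ((\det (pencil (U *m V) (- (U *m B' *m V))))`_h
       - (\det (pencil (U *m V) (- (U *m B *m V))))`_h).
  by rewrite !det_pencil_char_poly !coefZ -mulrBr (val_mul hv _ (_ - _)) d0 add0e.
have [[iU _ _] [iV _ _]] := (hU, hV).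
have hM (i j : 'I_n) : (((mu i)%:R : rat)%:E <= v ((- (U *m B *m V)) i j))%E.
  rewrite e !mxE valuationN //; case: (eqVneq i j) => _; first exact: hD.
  by rewrite (valuation0 hv) leey.
have hd (i j : 'I_n) :
  ((N%:R : rat)%:E <= v ((- (U *m B' *m V)) i j - (- (U *m B *m V)) i j)%R)%E.
  have -> : (- (U *m B' *m V)) i j - (- (U *m B *m V)) i j
      = - (c * (U *m G *m V) i j).
    rewrite -[B'](subrK B) eB mulmxDr mulmxDl -scalemxAr -scalemxAl.
    by rewrite !mxE; ring.
  rewrite valuationN // -[X in X%:E]addr0; apply: val_geM => //.
  have /mxOverP := val_integral_mulmx hv (val_integral_mulmx hv iU hG) iV.
  exact.
apply: det_pencil_sub_ge => //; first exact: val_integral_mulmx.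
move=> i j; rewrite -[X in v X](subrK ((- (U *m B *m V)) i j)).
apply: val_geD => //; apply: val_ge_weaken (hd i j); by rewrite ler_nat.
Qed.

End Pencil.

(** * Eigenvalue counts and splitting of characteristic polynomials *)

Lemma slope_mult_count (E C : fieldType) (j : {rmorphism E -> C})
    (v : C -> \bar rat) (L : nat) (B : 'M[E]_L) (a : rat) (s : seq C) :
  char_poly (map_mx j B) = \prod_(x <- s) ('X - x%:P) ->
  slope_mult j v B a = count (fun x => v x == a%:E) s.
Proof.
move=> e; rewrite /slope_mult /= e.
have -> : [set x | eigenvalue (map_mx j B) x /\ v x = a%:E]%classic
    = [set` [pred x | (x \in s) && (v x == a%:E)]]%classic.
  apply/seteqP; split=> x /=; rewrite eigenvalue_root_char e root_prod_XsubC inE.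
    by move=> [-> /eqP ->].
  by move=> /andP[-> /eqP ->].
rewrite -(@bigfs _ _ _ _ (undup s)) ?undup_uniq //; last first.
  by move=> x /andP[xs _]; rewrite mem_undup xs.
(* Grouping equal entries of the list turns the count into a sum of multiplicities. *)
rewrite -sum1_count -[RHS]big_undup_iterop_count big_seq_cond [RHS]big_seq_cond.
apply: eq_big => [x|x _]; first by rewrite /= mem_undup andbA andbb.
by rewrite mu_prod_XsubC; elim: (count_mem x s) => // -[|k] //= <-.
Qed.

(** The minimal polynomial of [x] over [F] splits in [Kbar], so [jE x] is the image of one of its
    roots there. *)
Lemma alg_elt_lift (F K : fieldType) (E : fieldExtType F) (Kbar : closedFieldType)
    (jbar : {rmorphism F -> Kbar}) (jK : {rmorphism Kbar -> K})
    (jE : {rmorphism E -> K}) :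
  (forall x : F, jE x%:A = jK (jbar x)) -> forall x : E, exists y, jE x = jK y.
Proof.
move=> h x.
have /polyOver1P [q eq] := minPolyOver 1%AS x.
have e : map_poly jE (minPoly 1%AS x) = map_poly jK (map_poly jbar q).
  rewrite eq -!map_poly_comp; apply: eq_map_poly => c /=; exact: h.
have [r er] := closed_field_poly_normal (map_poly jbar q).
have q0 : map_poly jK (map_poly jbar q) != 0.
  by rewrite -e map_poly_eq0 monic_neq0 ?monic_minPoly.
have : root (map_poly jE (minPoly 1%AS x)) (jE x).
  by rewrite fmorph_root root_minPoly.
rewrite e {1}er linearZ /= rootZ; last first.
  rewrite fmorph_eq0 lead_coef_eq0.
  by apply: contraNneq q0 => ->; rewrite rmorph0.
rewrite rmorph_prod /= (eq_bigr (fun z => 'X - (jK z)%:P)); last first.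
  by move=> z _; rewrite rmorphB /= map_polyX map_polyC.
rewrite -(big_map jK xpredT (fun z => 'X - z%:P)) root_prod_XsubC.
by case/mapP => y _ ->; exists y.
Qed.

Lemma char_poly_split_through (E K : fieldType) (Kbar : closedFieldType)
    (jK : {rmorphism Kbar -> K}) (jE : {rmorphism E -> K}) :
  (forall x : E, exists y, jE x = jK y) ->
  forall L (B : 'M[E]_L), exists s : seq K,
    char_poly (map_mx jE B) = \prod_(x <- s) ('X - x%:P).
Proof.
move=> h L B; have [f hf] := choice h.
have -> : map_mx jE B = map_mx jK (map_mx f B).
  by apply/matrixP => i j; rewrite !mxE.
have [r er] := closed_field_poly_normal (char_poly (map_mx f B)).
exists (map jK r); rewrite -map_char_poly er.
rewrite (monicP (char_poly_monic _)) scale1r rmorph_prod big_map /=.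
by apply: eq_bigr => z _; rewrite rmorphB /= map_polyX map_polyC.
Qed.

(** * The valuation of [wp] *)

(** The chosen representative may be unreduced, so the argument rests on [\n_x = wp * \d_x], which
    gives the numerator one more factor [wp]. *)
Lemma adic_val_tofrac_ge1 (F : fieldType) (wp : {poly F}) :
  irreducible_poly wp -> ((1 : rat)%:E <= adic_val wp (FracField.tofrac wp))%E.
Proof.
move=> [wp_gt1 _]; rewrite /adic_val; case: ifP => [_|_]; first by rewrite leey.
set x := repr _.
have d0 : \d_x != 0 by apply: denom_ratioP.
have e : \n_x = wp * \d_x.
  have := FracField.equivf_l (Ratio wp 1).
  rewrite !numden_Ratio ?oner_eq0 // mulr1 [RHS]mulrC.
  by rewrite /x /FracField.tofrac -lock.
have dvd_mult : wp ^+ poly_mult wp \d_x %| \d_x.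
  rewrite /poly_mult.
  elim/big_ind: _ => [|i j hi hj|i //]; first by rewrite expr0 dvd1p.
  by rewrite /maxn; case: ifP.
have wp0 : wp != 0 by rewrite -size_poly_gt0 ltnW.
have dvd_n : wp ^+ (poly_mult wp \d_x).+1 %| \n_x by rewrite e exprS dvdp_mul2l.
have size_exp_gt k : (k < size (wp ^+ k))%N.
  rewrite -(@prednK (size (wp ^+ k))) ?size_poly_gt0 ?expf_neq0 //.
  by rewrite ltnS size_exp leq_pmull // -subn1 subn_gt0.
(* The maximum in [poly_mult] only ranges over exponents below the size, so this exponent must be
   shown admissible. *)
have hlt : ((poly_mult wp \d_x).+1 < size \n_x)%N.
  apply: leq_trans (size_exp_gt _) (dvdp_leq _ dvd_n).
  by rewrite e mulf_neq0.
have H : ((poly_mult wp \d_x).+1 <= poly_mult wp \n_x)%N.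
  exact: (@leq_bigmax_cond _ (fun i : 'I_(size \n_x) => wp ^+ i %| \n_x)
    (fun i => i : nat) (Ordinal hlt)).
by rewrite lee_fin lerBrDr addrC natr1 ler_nat.
Qed.

(** * Closed forms of the partial sums and the constants *)

(** There are [q] blocks of length [d0], then [r] terms equal to [q]. Allowing [r = d0] lets the
    induction pass to the next block. *)
Lemma psum_div2 d0 (q r : nat) : (0 < d0)%N -> (r <= d0)%N ->
  (2 * (psum (fun i => i %/ d0)%N (d0 * q + r))%:R
   = d0%:R * q%:R * (q%:R - 1) + 2 * q%:R * r%:R :> rat).
Proof.
move=> d0_gt0; elim: q r => [|q IHq] r.
  elim: r => [_|r IHr hr]; first by rewrite /psum muln0 big_ord0; ring.
  rewrite addnS psumS natrD mulrDr IHr; last exact: ltnW.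
  by rewrite muln0 add0n divn_small //; ring.
elim: r => [_|r IHr hr].
  by rewrite addn0 mulnS addnC IHq // -addn1 natrD; ring.
rewrite addnS psumS natrD mulrDr IHr; last exact: ltnW.
by rewrite mulnC divnMDl // divn_small // addn0 -(addn1 r) natrD; ring.
Qed.

Lemma eq_psum (mu mu' : nat -> nat) l :
  (forall i, (i < l)%N -> mu i = mu' i) -> psum mu l = psum mu' l.
Proof. by move=> h; apply: eq_bigr => i _; apply: h. Qed.

Lemma psum_cap d0 N l : (0 < d0)%N -> (l <= d0 * N)%N ->
  psum (fun i => minn (i %/ d0) N) l = psum (fun i => i %/ d0)%N l.
Proof.
move=> d0_gt0 hl; apply: eq_psum => i hi; apply/minn_idPl.
by rewrite -ltnS ltn_divLR //; nia.
Qed.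

Lemma psum_cap_add d0 N k : (0 < d0)%N ->
  psum (fun i => minn (i %/ d0) N) (d0 * N + k)
  = (psum (fun i => i %/ d0)%N (d0 * N) + k * N)%N.
Proof.
move=> d0_gt0; elim: k => [|k IH]; first by rewrite !addn0 psum_cap.
rewrite addnS psumS IH (minn_idPr _); first by rewrite mulSn; lia.
by rewrite leq_divRL //; nia.
Qed.

Section Constants.
Variables (p n d0 eps : nat).
Let N := (p ^ n)%N.
Let T := psum (fun i => minn (i %/ d0) N).
Hypothesis d0_gt0 : (0 < d0)%N.
Hypothesis N_gt1 : (1 < N)%N.
Hypothesis eps_le : (eps <= d0)%N.

(** For [l >= 2], [l - 1 = d0 q_l + (r_l + 1)], so the numerator of [C2_term] is twice
    [N + T (l - 1)]. *)
Lemma C2_termE l : (0 < l)%N -> (l <= 1 + d0 * N)%N ->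
  C2_term p n d0 eps l = (N + T l.-1)%:R / (l%:R - eps%:R).
Proof.
move=> l0 hl; rewrite /C2_term.
set X := _ + _ * (_ + 1).
have -> : X = 2 * (N + T l.-1)%:R.
  rewrite natrD mulrDr /X /T psum_cap; [|by []|by lia].
  rewrite -addrA; congr (_ + _).
  case: l l0 hl {X} => // -[|l] _ hl.
    by rewrite /C2_q /C2_r /psum big_ord0 /=; ring.
  rewrite /C2_r /C2_q /= subSS subSS subn0.
  have el : (l.+1 = d0 * (l %/ d0) + (l %% d0).+1)%N.
    by rewrite addnS mulnC -divn_eq.
  rewrite [in RHS]el psum_div2 //; last by rewrite ltn_mod.
  have -> : (l - d0 * (l %/ d0) = l %% d0)%N by rewrite {1}(divn_eq l d0); lia.
  by rewrite -(addn1 (l %% d0)) natrD.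
rewrite invfM mulrACA mulfV ?mul1r //.
Qed.

Lemma C1_bounds : 0 < C1 p n d0 eps < N%:R.
Proof.
rewrite /C1 -/N.
have hN : 2 <= N%:R :> rat by rewrite ler_nat.
have hd : 1 <= d0%:R :> rat by rewrite ler1n.
have he : eps%:R <= d0%:R :> rat by rewrite ler_nat.
have he0 : 0 <= eps%:R :> rat by rewrite ler0n.
move: (N%:R) (d0%:R) (eps%:R) hN hd he he0 => x d e hN hd he he0.
have den : 0 < 4 + 2 * d * x - 2 * e by nra.
have num : 0 < 4 + d * x - d by nra.
rewrite mulr_gt0 ?divr_gt0 //=; try lra.
rewrite gtr_pMr; last lra.
(* This amounts to [2 e < d (x + 1)], which follows from [e <= d], [1 <= d] and [2 <= x]. *)
rewrite ltr_pdivrMr //; nra.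
Qed.

Lemma C2_gt0 : 0 < C2 p n d0 eps.
Proof.
have H l : (eps < l)%N -> (l <= 1 + d0 * N)%N -> 0 < C2_term p n d0 eps l.
  move=> h1 h2; rewrite C2_termE //; last by lia.
  by rewrite divr_gt0 // ?ltr0n ?subr_gt0 ?ltr_nat //; lia.
rewrite /C2 big_nat_cond; apply: lt_bigmin.
  by apply: H => //; nia.
by move=> l /andP[/andP[h1 h2] _]; apply: H.
Qed.

Lemma Cmin_bounds : 0 < Cmin p n d0 eps < N%:R.
Proof.
have /andP[h1 h2] := C1_bounds.
by rewrite /Cmin lt_min h1 C2_gt0 gt_min h2.
Qed.

(* For [l <= d0 N + 1] this is the definition of [C2]; past that point both sides
   are affine in [l], with slopes [a < N] and [N], so [l = d0 N + 2] is the
   binding case, and there it reads [a < C1]. *)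
Lemma lt_Cmin_slope a l : 0 <= a -> a < Cmin p n d0 eps ->
  a * (l%:R - eps%:R) < (N + T l.-1)%:R.
Proof.
move=> a0; rewrite /Cmin lt_min => /andP[aC1 aC2].
have N0 : 0 < N%:R :> rat by rewrite ltr0n; lia.
case: (leqP l eps) => hl.
  apply: (@le_lt_trans _ _ 0); last by rewrite ltr0n; lia.
  by rewrite mulr_ge0_le0 // subr_le0 ler_nat.
case: (leqP l (1 + d0 * N)) => hl2.
  rewrite -ltr_pdivlMr ?subr_gt0 ?ltr_nat // -C2_termE //; last by lia.
  apply: lt_le_trans aC2 _; rewrite /C2; apply: ge_bigmin_seq => //.
  by rewrite mem_index_iota hl ltnS.
have {hl2} [k ->] : exists k, l = (d0 * N + k.+1).+1.
  by exists (l - (d0 * N).+2)%N; lia.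
rewrite /= /T psum_cap_add //.
have := @psum_div2 d0 N 0 d0_gt0 (leq0n _); rewrite addn0 mulr0 addr0.
have /andP[C1_gt0 C1_lt] := C1_bounds.
have aN : a < N%:R := lt_trans aC1 C1_lt.
move: aC1; rewrite /C1 -/N mulrA ltr_pdivlMr; last first.
  have : eps%:R <= d0%:R :> rat by rewrite ler_nat.
  have hd : 1 <= d0%:R :> rat by rewrite ler1n.
  have hN : 2 <= N%:R :> rat by rewrite ler_nat.
  nra.
rewrite mulSn -(addn1 (_ + _)) !natrD !natrM -(addn1 k) natrD.
(* With denominators cleared, [a < C1] is twice the claim for [k = 0]; the other [k] steps add [a k]
   on the left and [k N] on the right. *)
have : a * k%:R <= k%:R * N%:R by rewrite mulrC ler_wpM2l // ltW.
nra.
Qed.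

End Constants.

(** * Comparison of the two characteristic polynomials *)

Lemma is_valuation_comp (E C : fieldType) (j : {rmorphism E -> C})
    (v : C -> \bar rat) : is_valuation v -> is_valuation (v \o j).
Proof.
move=> hv; split=> [x|x|x y|x y] /=.
- by rewrite (val_eq_pinfty hv) fmorph_eq0.
- exact: val_neq_ninfty.
- by rewrite rmorphM (val_mul hv).
- by rewrite rmorphD; apply: val_add_ge_min.
Qed.

Lemma val_ge_exp (K : fieldType) (v : K -> \bar rat) (x : K) N :
  is_valuation v -> ((1 : rat)%:E <= v x)%E ->
  ((N%:R : rat)%:E <= v (x ^+ N)%R)%E.
Proof.
move=> hv hx; elim: N => [|N IH]; first by rewrite expr0 valuation1.
by rewrite exprS -add1n natrD; apply: val_geM.
Qed.

(** The term of index [d0] is [minn 1 N], which is positive. *)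
Lemma psum_capped_eq0 d0 N l : (0 < d0)%N -> (0 < N)%N ->
  psum (fun i => minn (i %/ d0) N) l = 0%N -> (l <= d0)%N.
Proof.
move=> d0_gt0 N0; apply: contra_eqT; rewrite -ltnNge => hl; rewrite -lt0n.
rewrite /psum (bigD1 (Ordinal hl)) //= divnn d0_gt0 ltn_addr //.
by rewrite leq_min.
Qed.

Theorem proposition3p11
  (p q : nat) (hp : prime p) (hq1 : (1 < q)%N) (hq : p.-nat q)
  (Fq : finFieldType) (hFq : #|Fq| = q)
  (wp : {poly Fq}) (hwp : irreducible_poly wp)
  (* K_wp, the completion of K = Fq(t) *)
  (Kwp : fieldType) (vK : Kwp -> \bar rat)
  (jK : {rmorphism {fraction {poly Fq}} -> Kwp})
  (hKwp : is_completion (adic_val wp) vK jK)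
  (* an algebraic closure of K_wp, with the valuation extending that of K_wp *)
  (Kbar : closedFieldType) (vbar : Kbar -> \bar rat)
  (jbar : {rmorphism Kwp -> Kbar})
  (hKbar : forall x : Kbar, algebraicOver jbar x)
  (hvbar : is_valuation vbar)
  (hvbarK : forall x : Kwp, vbar (jbar x) = vK x)
  (* C_wp, the completion of the algebraic closure *)
  (C : fieldType) (v : C -> \bar rat) (jC : {rmorphism Kbar -> C})
  (hC : is_completion vbar v jC)
  (* a finite extension E of K_wp inside C_wp *)
  (E : fieldExtType Kwp) (jE : {rmorphism E -> C})
  (hE : forall x : Kwp, jE (x%:A) = jC (jbar x))
  (d0 n L : nat) (hd0 : (0 < d0)%N) (hn : (0 < n)%N) (hL : (0 < L)%N)
  (B : 'M[E]_L) (hB : B \is a mxOver (val_ring (v \o jE)))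
  (s : 'I_L -> \bar rat) (hs : elementary_divisors (v \o jE) B s)
  (hsd : forall i : 'I_L, (((i %/ d0)%N%:R : rat)%:E <= s i)%E) :
  let eps0 := slope_mult jE v B 0 in
  let wpE : E := (jK (FracField.tofrac wp))%:A in
  [/\ 0 < C1 p n d0 eps0 < (p ^ n)%N%:R,
      0 < Cmin p n d0 eps0 < (p ^ n)%N%:R
    & forall (B' : 'M[E]_L) (a : rat),
        B' \is a mxOver (val_ring (v \o jE)) ->
        mx_congr (v \o jE) (wpE ^+ (p ^ n)%N) B B' ->
        0 <= a -> a < Cmin p n d0 eps0 ->
        slope_mult jE v B a = slope_mult jE v B' a].
Proof.
move=> eps0 wpE.
have hv : is_valuation v := completion_val hC.
have hvE : is_valuation (v \o jE) := is_valuation_comp jE hv.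
have split_char := char_poly_split_through (alg_elt_lift hE).
have N_gt1 : (1 < p ^ n)%N by rewrite -(exp1n n) ltn_exp2r ?prime_gt1.
pose mu i := minn (i %/ d0) (p ^ n).
have mu_mono : {homo mu : i j / (i <= j)%N}.
  by move=> i j ij; rewrite leq_min geq_minr andbT geq_min leq_div2r.
have [_ [U [V [D [hU hV _ eD sD]]]]] := hs.
have hD (i : 'I_L) : (((mu i)%:R : rat)%:E <= (v \o jE) (D ord0 i))%E.
  by rewrite -sD; apply: le_trans (hsd i); rewrite lee_fin ler_nat geq_minl.
have [r er] := split_char L B.
have size_r : size r = L.
  have := size_char_poly (map_mx jE B).
  by rewrite er size_prod_XsubC => -[].
have eps0E : eps0 = count (fun x => v x == 0%E) r := slope_mult_count v 0 er.
have coefE M h : v (char_poly (map_mx jE M))`_h = (v \o jE) (char_poly M)`_h.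
  by rewrite -map_char_poly coef_map.
(* Take slope 0, with [i] the number of roots of positive valuation. The coefficient of index [i]
   has valuation [m <= 0], so [T (L - i) = 0] and [eps0 <= L - i <= d0]. *)
have eps_le : (eps0 <= d0)%N.
  have [m hm [_ hi _ _]] := newton_segment_roots hv r (lexx 0).
  set i := count (fun x => 0 < v x)%E r in hi.
  have := char_poly_coef_ge hvE mu_mono hU hV eD hD i.
  rewrite -coefE er hi lee_fin => hle.
  have psum0 : psum mu (L - i) = 0%N.
    by apply/eqP; rewrite -leqn0 -(ler_nat rat); lra.
  apply: leq_trans (psum_capped_eq0 hd0 (ltnW N_gt1) psum0).
  have : (i + eps0 <= L)%N.
    rewrite eps0E -size_r -count_predUI.
    rewrite [X in (_ + X)%N](_ : _ = 0%N) ?addn0 ?count_size //.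
    apply/eqP; rewrite -leqn0 leqNgt -has_count; apply/hasPn => x _ /=.
    by apply/negP => /andP[h1 /eqP h2]; move: h1; rewrite h2 ltxx.
  by lia.
split; [exact: C1_bounds|exact: Cmin_bounds|].
move=> B' a _ [G hG eB] a0 aC.
have wp_ge : (((p ^ n)%N%:R : rat)%:E <= (v \o jE) (wpE ^+ (p ^ n)%N)%R)%E.
  apply: val_ge_exp => //.
  rewrite /= hE (completion_extends hC) hvbarK (completion_extends hKwp).
  exact: adic_val_tofrac_ge1.
have [r' er'] := split_char L B'.
have [m hm seg] := newton_segment_roots hv r a0.
have [m' _ seg'] := newton_segment_roots hv r' a0.
(* Since [m <= a (L - eps0)], the level [m - a k] is at most [a (L - k - eps0)], which is below
   [N + T (L - k - 1)]. *)
have sub_ge k : ((m - a * k%:R)%:E <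
    v ((\prod_(x <- r') ('X - x%:P))`_k - (\prod_(x <- r) ('X - x%:P))`_k)%R)%E.
  rewrite -er -er' -!map_char_poly !coef_map -rmorphB.
  have := char_poly_sub_coef_ge hvE mu_mono hU hV eD hD (fun i => geq_minr _ _)
    wp_ge hG eB k.
  apply: lt_le_trans; rewrite lte_fin.
  apply: le_lt_trans (lt_Cmin_slope hd0 N_gt1 eps_le (L - k) a0 aC).
  (* For [k > L] the truncated [L - k] exceeds the rational difference, which is harmless as
     [a >= 0]. *)
  have : (L%:R - k%:R : rat) <= (L - k)%N%:R.
    by rewrite lerBlDr -natrD ler_nat addnC -leq_subLR.
  move=> hLk; apply: (@le_trans _ _ (a * (L%:R - k%:R - eps0%:R))).
    by rewrite size_r -eps0E in hm; lra.
  by rewrite ler_wpM2l // lerD2r.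
(* Both ends of the segments agree, hence so do their lengths, which count the roots of valuation
   [a]. *)
have [e1 e2] := newton_segment_uniq (newton_segment_perturb hv seg sub_ge) seg'.
rewrite (slope_mult_count v a er) (slope_mult_count v a er').
by move: e2; rewrite e1 => /addnI.
Qed.
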